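(* Let $\rho$ be a positive homogeneous polynomial on $\mathbf{C}^n$, i.e. a real-valued polynomial in $z^1,\dots,z^n,\bar z^1,\dots,\bar z^n$, homogeneous as a polynomial in the underlying real variables, with $\rho>0$ on $\mathbf{C}^n\setminus\{0\}$. Suppose that $u=\log\rho$ is plurisubharmonic and satisfies $$(dd^c u)^n=0$$ on $\mathbf{C}^n\setminus\{0\}$. Then $\rho$ is a homogeneous polynomial of bidegree $(k,k)$, where $2k$ is the degree of $\rho$.
   Context: A polynomial in $z,\bar z$ is homogeneous of bidegree $(l,m)$ if it is homogeneous of degree $l$ in $z=(z^1,\dots,z^n)$ and homogeneous of degree $m$ in $\bar z=(\bar z^1,\dots,\bar z^n)$. $d^c$ is the usual real operator with $dd^c$ a positive constant multiple of $i\partial\bar\partial$. *)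

(* Defs.v *)
From HB Require Import structures.
From mathcomp Require Import all_boot all_order all_fingroup all_algebra.
From mathcomp Require Import complex.
From mathcomp Require Import all_classical all_reals all_analysis.
(* mpoly's notations clash with those of mathcomp-analysis, so only its
   instances and coercions are imported. *)
From mathcomp Require multinomials.mpoly.
Import (canonicals, coercions) multinomials.mpoly.

Set Implicit Arguments.
Unset Strict Implicit.
Unset Printing Implicit Defensive.

Import Order.TTheory GRing.Theory Num.Theory numFieldNormedType.Exports.

Local Open Scope classical_set_scope.
Local Open Scope complex_scope.
Local Open Scope ring_scope.

(* A point of C^n is a row vector over R[i].  A polynomial in
   z^1, .., z^n, zbar^1, .., zbar^n is a polynomial P in n + n indeterminates
   with complex coefficients: the first n indeterminates stand for the z^j and
   the last n for the zbar^j. *)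

Definition zpoly (R : realType) (n : nat) := mpoly.mpoly (n + n) R[i].

Definition zeval (R : realType) n (P : zpoly R n) (z : 'rV[R[i]]_n) : R[i] :=
  mpoly.meval (fun i => row_mx z (map_mx conjc z) ord0 i) P.

Definition real_valued (R : realType) n (P : zpoly R n) : Prop :=
  forall z, complex.Im (zeval P z) = 0.

Definition re_zeval (R : realType) n (P : zpoly R n) (z : 'rV[R[i]]_n) : R :=
  complex.Re (zeval P z).

(* P rewritten in the underlying real variables by z^j = x^j + i y^j and
   zbar^j = x^j - i y^j; the indeterminates of the result are
   x^1, .., x^n, y^1, .., y^n. *)
Definition in_real_variables (R : realType) n (P : zpoly R n) :
    mpoly.mpoly (n + n) R[i] :=
  let x (j : 'I_n) : mpoly.mpoly (n + n) R[i] :=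
    mpoly.mpolyX R[i] (mpoly.mnm1 (lshift n j)) in
  let y (j : 'I_n) : mpoly.mpoly (n + n) R[i] :=
    mpoly.mpolyX R[i] (mpoly.mnm1 (rshift n j)) in
  mpoly.comp_mpoly
    [tuple match fintype.split i with
           | inl j => x j + 'i%C *: y j
           | inr j => x j - 'i%C *: y j
           end | i < n + n] P.

Definition real_homogeneous (R : realType) n (d : nat) (P : zpoly R n) : Prop :=
  in_real_variables P \is mpoly.ishomog1 d mpoly.mdeg.

Definition bihomogeneous (R : realType) n (l m : nat) (P : zpoly R n) : Prop :=
  forall a, a \in mpoly.msupp P ->
    (\sum_(j < n) a (lshift n j))%N = l /\ (\sum_(j < n) a (rshift n j))%N = m.

(* R[i] carries no canonical topology in the library, so semicontinuity is
   written with the sup-norm balls of C^n. *)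
Definition upper_semicontinuous_on (R : realType) n
    (D : set 'rV[R[i]]_n) (u : 'rV[R[i]]_n -> \bar R) : Prop :=
  forall z, D z -> forall c : R, (u z < c%:E)%E ->
  exists2 e : R, 0 < e &
    forall w, D w -> (forall j, `|w ord0 j - z ord0 j| < e%:C) ->
      (u w < c%:E)%E.

Definition expi (R : realType) (t : R) : R[i] := cos t +i* sin t.

(* Upper semicontinuous with values in [-oo, +oo[, and satisfying the sub-mean
   value inequality on every closed disc of a complex line contained in D. *)
Definition plurisubharmonic (R : realType) n
    (D : set 'rV[R[i]]_n) (u : 'rV[R[i]]_n -> \bar R) : Prop :=
  [/\ forall z, D z -> (u z < +oo)%E,
      upper_semicontinuous_on D u &
      forall a b : 'rV[R[i]]_n,
        (forall l : R[i], `|l| <= 1 -> D (a + l *: b)) ->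
        (u a <= ((2 * pi)^-1)%:E *
          \int[@lebesgue_measure R]_(t in `[0%R, (2 * pi)%R])
            u (a + expi t *: b)%R)%E].

(* Differential forms on the real vector space C^n: a k-form maps a point and
   k real tangent vectors to R, and is evaluated on constant vector fields. *)
Definition kform (R : realType) (n k : nat) := ('I_k -> 'rV[R[i]]_n) -> R.

Definition dform (R : realType) (n k : nat) := 'rV[R[i]]_n -> kform R n k.

Definition real_dir_derive (R : realType) n (f : 'rV[R[i]]_n -> R)
    (z v : 'rV[R[i]]_n) : R :=
  derive1 (fun t : R => f (z + t%:C *: v)) 0.

(* d alpha (v_0, .., v_k) = \sum_i (-1)^i v_i . alpha (v_0, .., ^v_i, .., v_k);
   the bracket terms vanish on constant vector fields. *)
Definition ext_d (R : realType) n k (alpha : dform R n k) : dform R n k.+1 :=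
  fun z v => \sum_(i < k.+1) (-1) ^+ i *
    real_dir_derive (fun w => alpha w (fun j => v (lift i j))) z (v i).

(* d^c u = - du o J = i (dbar - d) u, so that d d^c = 2 i d dbar. *)
Definition dc (R : realType) n (u : 'rV[R[i]]_n -> R) : dform R n 1 :=
  fun z v => - real_dir_derive u z ('i%C *: v ord0).

Definition ddc (R : realType) n (u : 'rV[R[i]]_n -> R) : dform R n 2 :=
  ext_d (dc u).

Definition wedge (R : realType) n k l (a : kform R n k) (b : kform R n l) :
    kform R n (k + l) :=
  fun v => (k`! * l`!)%:R^-1 * \sum_(s : 'S_(k + l)) (-1) ^+ s *
    (a (fun i => v (s (lshift l i))) * b (fun i => v (s (rshift k i)))).

(* m.+1 * 2 and 2 + m * 2 are convertible. *)
Fixpoint wedge_pow (R : realType) n (a : kform R n 2) (m : nat) :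
    kform R n (m * 2) :=
  match m return kform R n (m * 2) with
  | 0 => fun _ => 1
  | m'.+1 => wedge a (@wedge_pow R n a m')
  end.

Arguments wedge_pow {R n} a m _.

(* Main.v *)
(* On a complex line C z, homogeneity gives u(r e^(i s) z) = d ln r + phi(s)
   with phi continuous and 2 pi-periodic.  Let phi be maximal at z0 in the
   circle through z.  Since ln |l| is harmonic, the sub-mean value inequality
   on the disc of centre z0 and radius z0 / 2 says that phi(z0) is at most the
   mean of values of phi that do not exceed it, so phi is constant on the
   directions of 1 + e^(i t) / 2.  Now rho(e^(i s) z0) is a trigonometric
   polynomial in s; being constant at infinitely many points it is constant.
   Hence rho is invariant under z |-> e^(i s) z, which kills every coefficient
   of bidegree (l, m) with l <> m. *)
Require Import Defs.
From mathcomp Require Import all_boot all_order all_algebra.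
From mathcomp Require Import complex.
From mathcomp Require Import all_classical all_reals all_analysis.
From mathcomp Require multinomials.mpoly.
From mathcomp Require Import ring lra.
Import (canonicals, coercions) multinomials.mpoly.

Set Implicit Arguments.
Unset Strict Implicit.
Unset Printing Implicit Defensive.

Import Order.TTheory GRing.Theory Num.Theory numFieldNormedType.Exports.

Local Open Scope classical_set_scope.
Local Open Scope ring_scope.

(** * Polynomials vanishing at all points with natural coordinates *)

Lemma digits_inj (B n : nat) (a b : 'I_n -> nat) :
  (forall i, a i < B)%N -> (forall i, b i < B)%N ->
  (\sum_(i < n) a i * B ^ i = \sum_(i < n) b i * B ^ i)%N -> a =1 b.
Proof.
elim: n a b => [|n IHn] a b aB bB; first by move=> _ [].
(* In Horner form the lowest digit is the remainder modulo [B] and the other digits form the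
   quotient. *)
have unroll (c : 'I_n.+1 -> nat) : (\sum_(i < n.+1) c i * B ^ i =
    (\sum_(i < n) c (lift ord0 i) * B ^ i) * B + c ord0)%N.
  rewrite big_ord_recl expn0 muln1 addnC big_distrl /=; congr (_ + _)%N.
  by apply: eq_bigr => i _; rewrite expnS mulnCA [RHS]mulnC.
rewrite !unroll => eq_ab.
have B0 : (0 < B)%N by apply: leq_trans (aB ord0).
have /(congr1 (fun x => x %% B)%N) := eq_ab; rewrite !modnMDl !modn_small// => ab0.
have /(congr1 (fun x => x %/ B)%N) := eq_ab.
rewrite !divnMDl// !divn_small// !addn0 => /IHn ab i.
by have [j ->|->//] := unliftP ord0 i; apply: ab.
Qed.

Lemma poly_injective_roots_eq0 (F : idomainType) (q : {poly F}) (w : nat -> F) :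
  injective w -> (forall k, root q (w k)) -> q = 0.
Proof.
move=> w_inj q0; apply/eqP/contraT => nzq.
have /(max_poly_roots nzq) : all (root q) [seq w k | k <- iota 0 (size q)].
  by apply/allP => _ /mapP[k _ ->].
by rewrite size_map size_iota ltnn map_inj_uniq ?iota_uniq// => /(_ isT).
Qed.

(* Kronecker substitution: the indeterminate of index [i] is sent to
   ['X^(B ^ i)] with [B] larger than every exponent of [P]. *)
Lemma mpoly_nat_zeros_eq0 (F : numDomainType) n (P : mpoly.mpoly n F) :
  (forall v : 'I_n -> nat, mpoly.meval (fun i => (v i)%:R) P = 0) -> P = 0.
Proof.
move=> P0; pose B := mpoly.mmeasure mpoly.mdeg P.
pose e (m : mpoly.multinom n) := (\sum_(i < n) m i * B ^ i)%N.
pose q : {poly F} := \sum_(m <- mpoly.msupp P) mpoly.mcoeff m P *: 'X^(e m).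
have q0 : q = 0.
  apply: (@poly_injective_roots_eq0 _ _ (fun k => k%:R)) => [a b /eqP|k].
    by rewrite eqr_nat => /eqP.
  apply/rootP; rewrite -[RHS](P0 (fun i => k ^ B ^ i)%N).
  rewrite mpoly.mevalE horner_sum; apply: eq_bigr => m _.
  rewrite hornerZ hornerXn /e -prodrXr; congr (_ * _); apply: eq_bigr => i _.
  by rewrite mulnC exprM natrX.
(* [mmeasure] exceeds the total degree of every monomial, so each exponent is a digit in base
   [B]. *)
have digit_lt m i : m \in mpoly.msupp P -> (m i < B)%N.
  move=> /(mpoly.mmeasure_mnm_lt mpoly.mdeg); apply: leq_ltn_trans.
  by rewrite /= mpoly.mdegE (bigD1 i)//= leq_addr.
apply/mpoly.mpolyP => m; rewrite mpoly.mcoeff0.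
have [mP|/mpoly.memN_msupp_eq0//] := boolP (m \in mpoly.msupp P).
have := congr1 (fun p : {poly F} => p`_(e m)) q0.
rewrite coef0 coef_sum (bigD1_seq m)//= ?mpoly.msupp_uniq//.
rewrite coefZ coefXn eqxx mulr1 big_seq_cond big1 ?addr0// => m' /andP[m'P ne].
rewrite coefZ coefXn; case: eqP => [/esym em|]; last by rewrite mulr0.
case/eqP: ne; apply/mpoly.mnmP.
by apply: digits_inj em => i; apply: digit_lt.
Qed.

(** * Polynomials in z and zbar: real variables and comparison of coefficients *)

Section ZPoly.
Context (R : realType) (n : nat).
Implicit Types (P : zpoly R n) (z : 'rV[R[i]]_n) (v : 'I_(n + n) -> R[i]).

(** The point [v] may be complex, which lets [zeval_eq0] invert the substitution. *)
Lemma meval_in_real_variables P v :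
  mpoly.meval v (in_real_variables P) =
  mpoly.meval (fun i => match fintype.split i with
    | inl j => v (lshift n j) + 'i%C * v (rshift n j)
    | inr j => v (lshift n j) - 'i%C * v (rshift n j)
    end) P.
Proof.
rewrite /in_real_variables mpoly.comp_mpoly_meval; apply: mpoly.meval_eq => i.
rewrite tnth_mktuple; case: (fintype.split i) => j.
  by rewrite mpoly.mevalD mpoly.mevalZ !mpoly.mevalXU.
by rewrite mpoly.mevalB mpoly.mevalZ !mpoly.mevalXU.
Qed.

Lemma zevalE P z :
  zeval P z = mpoly.meval
    (fun i => match fintype.split i with
       | inl j => (complex.Re (z ord0 j))%:C%C
       | inr j => (complex.Im (z ord0 j))%:C%C end) (in_real_variables P).
Proof.
rewrite meval_in_real_variables; apply: mpoly.meval_eq => i.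
rewrite mxE; case: fintype.splitP => j _; rewrite ?mxE.
  rewrite (unsplitK (inl _ : 'I_n + 'I_n)%type).
  by rewrite (unsplitK (inr _ : 'I_n + 'I_n)%type) -complexE.
rewrite (unsplitK (inl _ : 'I_n + 'I_n)%type).
rewrite (unsplitK (inr _ : 'I_n + 'I_n)%type) /conjc.
by case: (z ord0 j) => x y /=; simpc.
Qed.

(** Only points with zbar conjugate to z are tested. In the variables x, y they include all natural
    points, so the polynomial in x, y is formally zero, and then so is [P]. *)
Lemma zeval_eq0 P : (forall z, zeval P z = 0) -> P = 0.
Proof.
move=> P0.
have Q0 : in_real_variables P = 0.
  apply: mpoly_nat_zeros_eq0 => v.
  pose z : 'rV[R[i]]_n :=
    \row_j ((v (lshift n j))%:R +i* (v (rshift n j))%:R)%C.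
  rewrite -(P0 z) zevalE; apply: mpoly.meval_eq => i.
  case: (split_ordP i) => j ->; rewrite mxE /=; exact: esym (rmorph_nat _ _).
(* With x = (a + b) / 2 and y = (a - b) / (2 i), x + i y = a and x - i y = b are independent natural
   numbers. *)
apply: mpoly_nat_zeros_eq0 => v.
have := congr1 (mpoly.meval (fun i => match fintype.split i with
  | inl j => (((v (lshift n j))%:R + (v (rshift n j))%:R) / 2 : R[i])
  | inr j => ((v (lshift n j))%:R - (v (rshift n j))%:R) / (2 * 'i%C) end)) Q0.
rewrite mpoly.meval0 meval_in_real_variables => <-.
have i0 : 'i%C != 0 :> R[i] by rewrite eq_complex /= oner_eq0 andbF.
apply: mpoly.meval_eq => i.
case: (split_ordP i) => j ->.
  rewrite !(unsplitK (inl _ : 'I_n + 'I_n)%type).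
  rewrite !(unsplitK (inr _ : 'I_n + 'I_n)%type).
  by field.
rewrite !(unsplitK (inl _ : 'I_n + 'I_n)%type).
rewrite !(unsplitK (inr _ : 'I_n + 'I_n)%type).
by field.
Qed.

Lemma zevalE_monomials P z (l : R[i]) :
  zeval P (l *: z) = \sum_(m <- mpoly.msupp P)
    mpoly.mcoeff m P *
    (l ^+ (\sum_(j < n) m (lshift n j)) * (l^*)%C ^+ (\sum_(j < n) m (rshift n j))
     * \prod_i row_mx z (map_mx conjc z) ord0 i ^+ m i).
Proof.
rewrite /zeval mpoly.mevalE; apply: eq_bigr => m _; congr (_ * _).
rewrite !big_split_ord /= -!prodrXr mulrACA; congr (_ * _).
  rewrite -big_split /=; apply: eq_bigr => j _.
  by rewrite !row_mxEl mxE exprMn.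
rewrite -big_split /=; apply: eq_bigr => j _.
by rewrite !row_mxEr !mxE rmorphM exprMn.
Qed.

(** P(l z) - c P(z) is again a polynomial in z, zbar, so all its coefficients vanish. A real [l]
    will give the degree, a unit [l] the bidegree. *)
Lemma zeval_scale_eq P (l c : R[i]) m :
  (forall z, zeval P (l *: z) = c * zeval P z) -> m \in mpoly.msupp P ->
  l ^+ (\sum_(j < n) m (lshift n j)) * (l^*)%C ^+ (\sum_(j < n) m (rshift n j))
    = c.
Proof.
move=> Plc mP; pose w (m : mpoly.multinom (n + n)) :=
  l ^+ (\sum_(j < n) m (lshift n j)) * (l^*)%C ^+ (\sum_(j < n) m (rshift n j)).
pose Q : zpoly R n := \sum_(m <- mpoly.msupp P)
  (mpoly.mcoeff m P * (w m - c)) *: mpoly.mpolyX R[i] m.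
have Q0 : Q = 0.
  apply: zeval_eq0 => z; rewrite /zeval raddf_sum /=.
  apply: etrans (_ : zeval P (l *: z) - c * zeval P (1 *: z) = 0).
    rewrite !zevalE_monomials mulr_sumr -sumrB; apply: eq_bigr => a _.
    rewrite mpoly.mevalZ mpoly.mevalX /w !expr1n rmorph1 !expr1n; ring.
  by rewrite Plc scale1r subrr.
have := congr1 (mpoly.mcoeff m) Q0; rewrite mpoly.mcoeff0 raddf_sum /=.
rewrite (bigD1_seq m)//= ?mpoly.msupp_uniq//.
rewrite mpoly.mcoeffZ mpoly.mcoeffX eqxx mulr1 big1 ?addr0 => [|a /negPf am].
  by move/eqP; rewrite mulf_eq0 mpoly.mcoeff_eq0 mP subr_eq0 => /eqP.
by rewrite mpoly.mcoeffZ mpoly.mcoeffX am mulr0.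
Qed.

Lemma zeval_real_scale d P (r : R) z : real_homogeneous d P ->
  zeval P (r%:C%C *: z) = r%:C%C ^+ d * zeval P z.
Proof.
move=> /mpoly.dhomogP dP; rewrite !zevalE !mpoly.mevalE mulr_sumr.
rewrite big_seq [RHS]big_seq; apply: eq_bigr => m mQ.
rewrite mulrCA; congr (_ * _).
rewrite -[in RHS](dP m mQ) /= mpoly.mdegE -prodrXr -big_split /=.
apply: eq_bigr => i _; rewrite -exprMn; congr (_ ^+ _).
by case: (fintype.split i) => j; rewrite mxE;
  case: (z ord0 j) => x y; rewrite /=; simpc.
Qed.

End ZPoly.

(** * Integrals of continuous functions and the circle mean of ln |1 + a e^(i x)| *)

Section Integrals.
Context {R : realType}.
Implicit Types (f g : R -> R) (a b x : R).
Notation mu := (@lebesgue_measure R).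

Lemma continuous_integrable_itv f a b : continuous f ->
  mu.-integrable `[a, b] (EFin \o f).
Proof.
move=> cf; apply: continuous_compact_integrable; first exact: segment_compact.
exact: continuous_subspaceT.
Qed.

(** A base point left of the interval of interest makes the primitive differentiable at the left
    endpoint too. *)
Lemma continuous_primitive f a : continuous f ->
  exists2 F : R -> R, (forall x, a < x -> is_derive x 1 F (f x)) &
    forall x y, a <= x -> x <= y -> \int[mu]_(t in `[x, y]) f t = F y - F x.
Proof.
move=> cf; exists (fun x => \int[mu]_(t in `[a, x]) f t) => [x ax|x y ax xy].
  have [|||//|dF F'] := @continuous_FTC1_closed _ f a x (x + 1).
  - by rewrite ltrDl.
  - exact: continuous_integrable_itv.
  - by [].
  - exact: cf.
  by apply: DeriveDef => //; rewrite -derive1E F'.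
rewrite Rintegral_itvB ?bnd_simp//; last exact: continuous_integrable_itv.
rewrite Rintegral_itv_obnd_cbnd//.
apply: integrableS (continuous_integrable_itv x y cf) => //.
exact: subset_itv_oc_cc.
Qed.

(** A primitive of [f] is nondecreasing but does not grow from [a] to [b], so it is constant in
    between. *)
Lemma continuous_Rintegral_eq0 f a b : continuous f ->
  (forall x, 0 <= f x) -> \int[mu]_(x in `[a, b]) f x <= 0 ->
  forall x, a < x < b -> f x = 0.
Proof.
move=> cf f0 intf x /andP[ax xb].
have [F dF intE] := continuous_primitive (a - 1) cf.
have Fcst : \forall y \near x, F y = cst (F a) y.
  near=> y.
  have : y \in `]a, b[ by near: y; apply: near_in_itvoo; rewrite in_itv/= ax.
  rewrite in_itv/= => /andP[/ltW ay /ltW yb].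
  have: 0 <= F y - F a.
    rewrite -intE//; last by lra.
    exact: Rintegral_ge0.
  have : 0 <= F b - F y.
    rewrite -intE//; last by lra.
    exact: Rintegral_ge0.
  by move: intf; rewrite intE /=; lra.
have [] := dF x; first lra.
by move=> _ <-; rewrite (near_eq_derive _ Fcst) derive_cst.
Unshelve. all: by end_near. Qed.

(* [2 * ln |1 + a e^(i x)|]; its mean over the circle is [0], by iterating the
   doubling identity coming from [(1 + w) * (1 - w) = 1 - w ^+ 2]. *)
Definition ln_circle a x : R := ln (1 + 2 * a * cos x + a ^+ 2).

Lemma norm_mulcos_le a x : `|a| <= 1 / 2 -> `|a * cos x| <= 1 / 2.
Proof.
move=> ha; rewrite normrM -[leRHS]mulr1 ler_pM// ler_norml.
by rewrite cos_geN1 cos_le1.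
Qed.

Lemma ln_circle_arg_gt0 a x : `|a| <= 1 / 2 -> 0 < 1 + 2 * a * cos x + a ^+ 2.
Proof.
move=> ha; have := @norm_mulcos_le a x ha; rewrite ler_norml => /andP[+ _].
by have := sqr_ge0 a; nra.
Qed.

Lemma continuous_ln_circle a : `|a| <= 1 / 2 -> continuous (ln_circle a).
Proof.
move=> ha x; apply: continuous_comp; last exact/continuous_ln/ln_circle_arg_gt0.
apply: cvgD; last exact: cvg_cst.
apply: cvgD; first exact: cvg_cst.
by apply: cvgM; [exact: cvg_cst|exact: continuous_cos].
Qed.

Lemma ln_circle_double a x : `|a| <= 1 / 2 ->
  ln_circle a x + ln_circle a (x + pi) = ln_circle (- a ^+ 2) (2 * x).
Proof.
move=> ha; rewrite /ln_circle -lnM ?posrE ?ln_circle_arg_gt0// cosDpi.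
by congr ln; rewrite [2 * x]mulr_natl cos_mulr2n; ring.
Qed.

Lemma norm_oppr_sqr_le a : `|a| <= 1 / 2 -> `|- a ^+ 2| <= 1 / 2.
Proof. by rewrite normrN normrX; have := normr_ge0 a; nra. Qed.

(** Integrate the doubling identity over [0, pi]: the left side covers a full period, the right side
    is rescaled by x -> 2 x. The change of variables is done on primitives. *)
Lemma integral_ln_circle_double a : `|a| <= 1 / 2 ->
  \int[mu]_(x in `[0, 2 * pi]) ln_circle a x =
  (\int[mu]_(x in `[0, 2 * pi]) ln_circle (- a ^+ 2) x) / 2.
Proof.
move=> ha; have hb := norm_oppr_sqr_le ha.
have [A dA intA] := continuous_primitive (- 1) (continuous_ln_circle ha).
have [B dB intB] := continuous_primitive (- 1) (continuous_ln_circle hb).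
have pi0 := pi_gt0 R.
rewrite intA ?intB; try lra.
(* [D' = 0] by the doubling identity, and the claim is [D 0 = D pi]. *)
pose D x := A x + A (x + pi) - 2^-1 * B (2 * x).
(* This bound keeps [2 * x] to the right of the base point -1. *)
have dD x : -1 / 2 < x -> is_derive x (1 : R) D 0.
  move=> x0.
  have dAx : is_derive x (1 : R) A (ln_circle a x) by apply: dA; lra.
  have dApi : is_derive (x + pi) (1 : R) A (ln_circle a (x + pi))
    by apply: dA; lra.
  have dB2 : is_derive (2 * x) (1 : R) B (ln_circle (- a ^+ 2) (2 * x))
    by apply: dB; lra.
  have dsum := is_deriveB
    (is_deriveD dAx (@is_derive1_comp _ A (fun x => x + pi) x _ _ dApi
      (is_deriveD (is_derive_id x 1) (is_derive_cst pi x 1))))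
    (is_deriveZ 2^-1 (@is_derive1_comp _ B (fun x => 2 * x) x _ _ dB2
      (is_deriveZ 2 (is_derive_id x 1)))).
  apply: (is_derive_eq dsum); rewrite -ln_circle_double// /GRing.scale /=.
  by field.
have [||c _] := @MVT _ D (fun=> 0) 0 pi pi0.
- by move=> y; rewrite in_itv/= => /andP[x0 _]; apply: dD; lra.
- apply: derivable_within_continuous => x; rewrite in_itv/= => /andP[x0 _].
  by have [] := dD x; first lra.
rewrite mul0r /D mulr0 add0r (_ : pi + pi = 2 * pi); first lra.
by ring.
Qed.

(* The doubling identity halves any upper bound that is uniform in [a]. *)
Lemma integral_ln_circle_le0 a : `|a| <= 1 / 2 ->
  \int[mu]_(x in `[0, 2 * pi]) ln_circle a x <= 0.
Proof.
have bound k : forall a, `|a| <= 1 / 2 ->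
    \int[mu]_(x in `[0, 2 * pi]) ln_circle a x <= 6 * pi / 2 ^+ k.
  elim: k => [|k IHk] {}a ha.
    (* Since ln y < y, the integrand is at most 1 + 1 + 1/4 <= 3, over a length 2 pi. *)
    have -> : 6 * pi / 2 ^+ 0 = \int[mu]_(x in `[0, 2 * pi]) (cst 3 x : R).
      rewrite Rintegral_cst//= lebesgue_measure_itv /= lte_fin.
      rewrite mulr_gt0 ?pi_gt0//=. by rewrite expr0 divr1 subr0; ring.
    apply: le_Rintegral => //.
    - exact/continuous_integrable_itv/continuous_ln_circle.
    - by apply: continuous_integrable_itv => ?; exact: cvg_cst.
    move=> x _; apply: le_trans (ltW (ln_sublinear (ln_circle_arg_gt0 _ ha))) _ => /=.
    have := @norm_mulcos_le a x ha; rewrite ler_norml => /andP[_].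
    by move: ha; rewrite ler_norml => /andP[]; nra.
  rewrite integral_ln_circle_double// [2 ^+ k.+1]exprS invfM.
  by have := IHk _ (norm_oppr_sqr_le ha); lra.
move=> ha; rewrite leNgt; apply/negP => I0.
(* Were the integral I positive, some k would satisfy 6 pi < k I <= 2^k I, against [bound]. *)
have C0 : 0 <= 6 * pi / \int[mu]_(x in `[0, 2 * pi]) ln_circle a x.
  by rewrite divr_ge0 ?(ltW I0)// mulr_ge0 ?pi_ge0.
have := archi_boundP C0; set k := Num.bound _; rewrite ltr_pdivrMr// => kI.
have /(_ k) := bound _ a ha; rewrite ler_pdivlMr ?exprn_gt0// leNgt => /negP; apply.
apply: lt_le_trans kI _; rewrite mulrC ler_pM2l//.
by rewrite -natrX ler_nat ltnW// ltn_expl.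
Qed.

End Integrals.

(** * The unit circle, polar form, and continuity of complex-valued functions *)

Section Expi.
Context {R : realType}.
Implicit Types (t : R) (l : R[i]).

Lemma expiD t1 t2 : expi (t1 + t2) = expi t1 * expi t2.
Proof. by rewrite /expi cosD sinD; congr (_ +i* _)%C; ring. Qed.

Lemma expi0 : expi 0 = 1 :> R[i].
Proof. by rewrite /expi cos0 sin0. Qed.

Lemma conjc_expi t : ((expi t)^*)%C = expi (- t).
Proof. by rewrite /expi cosN sinN. Qed.

Lemma expi_conjc_mul t : expi t * ((expi t)^*)%C = 1.
Proof. by rewrite conjc_expi -expiD subrr expi0. Qed.

Lemma expi_neq0 t : expi t != 0 :> R[i].
Proof.
apply/eqP => e0; have := expi_conjc_mul t; rewrite e0 mul0r => /esym/eqP.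
by rewrite oner_eq0.
Qed.

Lemma expiX t k : expi t ^+ k = expi (k%:R * t).
Proof.
elim: k => [|k IHk]; first by rewrite mul0r expi0.
by rewrite exprS IHk -expiD -natr1 mulrDl mul1r addrC.
Qed.

(** The range of [t] reduces maxima over the circle to a compact interval; the value of [r ^+ 2]
    lets callers identify [r]. *)
Lemma polar_decomposition l : l != 0 ->
  exists2 t, t \in `[- pi, pi] & exists r : R,
    [/\ 0 < r, r ^+ 2 = complex.Re l ^+ 2 + complex.Im l ^+ 2
      & l = r%:C%C * expi t].
Proof.
case: l => x y; rewrite eq_complex /= negb_and => xy0.
have s0 : 0 < x ^+ 2 + y ^+ 2.
  rewrite lt_neqAle addr_ge0 ?sqr_ge0// andbT eq_sym paddr_eq0 ?sqr_ge0//.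
  by rewrite !sqrf_eq0 negb_and.
pose r := Num.sqrt (x ^+ 2 + y ^+ 2).
have r0 : 0 < r by rewrite sqrtr_gt0.
have r2 : r ^+ 2 = x ^+ 2 + y ^+ 2 by rewrite sqr_sqrtr// ltW.
have xr : -1 <= x / r <= 1.
  by rewrite ler_pdivlMr// ler_pdivrMr//; apply/andP; split; nra.
have sinE : sin (acos (x / r)) = `|y| / r.
  have ratioE : 1 - (x / r) ^+ 2 = (y / r) ^+ 2.
    by rewrite !expr_div_n r2; field; rewrite gt_eqF.
  by rewrite sin_acos// ratioE sqrtr_sqr normf_div (gtr0_norm r0).
have acos_itv : 0 <= acos (x / r) <= pi by rewrite acos_ge0// acos_lepi.
have cosE : cos (acos (x / r)) = x / r by rewrite acosK// in_itv.
(* [acos] only reaches the upper half-plane; below it the angle is negated. *)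
have [y0|y0] := leP 0 y.
  exists (acos (x / r)).
    by move: acos_itv; rewrite in_itv /= => /andP[]; have := pi_ge0 R; lra.
  exists r; split => //; rewrite /expi sinE cosE ger0_norm//; simpc.
  by congr (_ +i* _)%C; field; rewrite gt_eqF.
exists (- acos (x / r)).
  by move: acos_itv; rewrite in_itv /= => /andP[]; have := pi_ge0 R; lra.
exists r; split => //; rewrite /expi sinN cosN sinE cosE ltr0_norm//; simpc.
by congr (_ +i* _)%C; field; rewrite gt_eqF.
Qed.

(** Stated on real and imaginary parts, so that only the topology of [R] is involved. *)
Definition ccontinuous (f : R -> R[i]) :=
  continuous (fun t => complex.Re (f t)) /\ continuous (fun t => complex.Im (f t)).

Lemma ccontinuous_cst l : ccontinuous (fun=> l).
Proof. by split=> t; apply: cvg_cst. Qed.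

Lemma ccontinuousD f g : ccontinuous f -> ccontinuous g ->
  ccontinuous (fun t => f t + g t).
Proof.
move=> [f1 f2] [g1 g2]; split=> t.
  rewrite (_ : (fun t => complex.Re (f t + g t)) =
    (fun t => complex.Re (f t) + complex.Re (g t))); last first.
    by apply/funext => s; rewrite raddfD.
  by apply: cvgD; [exact: f1|exact: g1].
rewrite (_ : (fun t => complex.Im (f t + g t)) =
  (fun t => complex.Im (f t) + complex.Im (g t))); last first.
  by apply/funext => s; rewrite raddfD.
by apply: cvgD; [exact: f2|exact: g2].
Qed.

Lemma ccontinuousM f g : ccontinuous f -> ccontinuous g ->
  ccontinuous (fun t => f t * g t).
Proof.
move=> [f1 f2] [g1 g2]; split=> t.
  rewrite (_ : (fun t => complex.Re (f t * g t)) = (fun t =>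
    complex.Re (f t) * complex.Re (g t) - complex.Im (f t) * complex.Im (g t)));
    last by apply/funext => s; case: (f s); case: (g s).
  by apply: cvgB; apply: cvgM; [exact: f1|exact: g1|exact: f2|exact: g2].
rewrite (_ : (fun t => complex.Im (f t * g t)) = (fun t =>
  complex.Re (f t) * complex.Im (g t) + complex.Im (f t) * complex.Re (g t)));
  last by apply/funext => s; case: (f s); case: (g s).
by apply: cvgD; apply: cvgM; [exact: f1|exact: g2|exact: f2|exact: g1].
Qed.

Lemma ccontinuousX f k : ccontinuous f -> ccontinuous (fun t => f t ^+ k).
Proof.
move=> cf; elim: k => [|k IHk]; first exact: ccontinuous_cst.
under eq_fun do rewrite exprS.
exact: ccontinuousM.
Qed.

Lemma ccontinuous_conjc f : ccontinuous f -> ccontinuous (fun t => (f t)^*%C).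
Proof.
move=> [f1 f2]; split=> t.
  rewrite (_ : (fun t => complex.Re (f t)^*%C) = (fun t => complex.Re (f t))).
    exact: f1.
  by apply/funext => s; case: (f s).
rewrite (_ : (fun t => complex.Im (f t)^*%C) = (fun t => - complex.Im (f t))).
  by apply: cvgN; exact: f2.
by apply/funext => s; case: (f s).
Qed.

Lemma ccontinuous_sum I (r : seq I) (F : I -> R -> R[i]) :
  (forall i, ccontinuous (F i)) -> ccontinuous (fun t => \sum_(i <- r) F i t).
Proof.
move=> cF; elim: r => [|i r IHr].
  by under eq_fun do rewrite big_nil; exact: ccontinuous_cst.
by under eq_fun do rewrite big_cons; exact: ccontinuousD.
Qed.

Lemma ccontinuous_expi : ccontinuous (@expi R).
Proof. by split; [exact: continuous_cos|exact: continuous_sin]. Qed.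

Lemma ccontinuous_zeval n (P : zpoly R n) (z : 'rV[R[i]]_n) f :
  ccontinuous f -> ccontinuous (fun t => zeval P (f t *: z)).
Proof.
move=> cf; under eq_fun do rewrite zevalE_monomials.
apply: ccontinuous_sum => m; apply: ccontinuousM; first exact: ccontinuous_cst.
apply: ccontinuousM; last exact: ccontinuous_cst.
by apply: ccontinuousM; apply: ccontinuousX => //; exact: ccontinuous_conjc.
Qed.

End Expi.

(** * Restriction of the polynomial to a complex line *)

Section LineRestriction.
Context {R : realType} {n : nat}.
Variables (P : zpoly R n) (d : nat).
Implicit Types (z : 'rV[R[i]]_n) (t s r : R).
Notation mu := (@lebesgue_measure R).

Lemma real_valued_zevalE z : real_valued P -> zeval P z = (re_zeval P z)%:C%C.
Proof. by move=> rP; rewrite [LHS]complexE rP mulr0 addr0. Qed.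

Lemma re_zeval_real_scale r z : real_homogeneous d P ->
  re_zeval P (r%:C%C *: z) = r ^+ d * re_zeval P z.
Proof.
move=> hP; rewrite /re_zeval (zeval_real_scale _ _ hP) -rmorphXn /=.
by case: (zeval P z) => x y; rewrite /= mul0r subr0.
Qed.

(** [lam t *: z] runs over the boundary of the disc of centre z and radius z / 2, which avoids 0
    when z does. *)
Let lam t : R[i] := 1 + (1 / 2)%:C%C * expi t.

Lemma lam_sqr_norm t : complex.Re (lam t) ^+ 2 + complex.Im (lam t) ^+ 2 =
  1 + 2 * (1 / 2) * cos t + (1 / 2) ^+ 2.
Proof.
rewrite /lam /expi /= !mul0r subr0 addr0 add0r.
by have := cos2Dsin2 t; nra.
Qed.

Lemma norm_half_le : `|1 / 2 : R| <= 1 / 2.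
Proof. by rewrite ger0_norm. Qed.

Lemma lam_neq0 t : lam t != 0.
Proof.
apply/eqP => l0; have := lam_sqr_norm t; rewrite l0 /= => e.
by have := ln_circle_arg_gt0 t norm_half_le; rewrite -e expr0n addr0 ltxx.
Qed.

Hypothesis P_homog : real_homogeneous d P.
Hypothesis P_pos : forall z, z != 0 -> 0 < re_zeval P z.

Lemma expi_scale_neq0 t z : z != 0 -> expi t *: z != 0.
Proof. by move=> z0; rewrite scaler_eq0 negb_or z0 expi_neq0. Qed.

(** The maximum over [-pi, pi] is global, since the polar form brings every angle back there. *)
Lemma unit_circle_max z : exists s0 : R, forall s,
  re_zeval P (expi s *: z) <= re_zeval P (expi s0 *: z).
Proof.
have [cf _] := ccontinuous_zeval P z ccontinuous_expi.
have [||s0 _ maxs0] := @EVT_max _ (fun s => re_zeval P (expi s *: z)) (- pi) pi.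
- by have := pi_ge0 R; lra.
- exact: continuous_subspaceT.
exists s0 => s.
have [t tI [r [r0 r2 ->]]] := polar_decomposition (expi_neq0 s).
move: r2; rewrite /expi /= cos2Dsin2 => /eqP; rewrite sqrf_eq1 => /orP[]/eqP r1.
  by rewrite r1 mul1r; exact: maxs0.
by exfalso; move: r0; rewrite r1 ltr0N1.
Qed.

Hypothesis P_psh : plurisubharmonic [set z : 'rV[R[i]]_n | z != 0]
  (fun z => (ln (re_zeval P z))%:E).

Lemma continuous_ln_re_zeval z : z != 0 ->
  continuous (fun t => ln (re_zeval P (lam t *: z))).
Proof.
move=> z0 t; apply: continuous_comp; last first.
  by apply/continuous_ln/P_pos; rewrite scaler_eq0 negb_or lam_neq0.
have clam : ccontinuous lam.
  apply: ccontinuousD; first exact: ccontinuous_cst.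
  by apply: ccontinuousM; [exact: ccontinuous_cst|exact: ccontinuous_expi].
by have [+ _] := ccontinuous_zeval P z clam; apply.
Qed.

Lemma psh_circle_mean z : z != 0 ->
  2 * pi * ln (re_zeval P z) <=
  \int[mu]_(t in `[0, 2 * pi]) ln (re_zeval P (lam t *: z)).
Proof.
move=> z0; case: P_psh => _ _ /(_ z ((1 / 2)%:C%C *: z)).
have lamE t : z + expi t *: ((1 / 2)%:C%C *: z) = lam t *: z.
  by rewrite scalerA [RHS]scalerDl scale1r mulrC.
under eq_integral do rewrite lamE.
have intU : mu.-integrable `[0, 2 * pi]
    (EFin \o (fun t => ln (re_zeval P (lam t *: z)))).
  exact/continuous_integrable_itv/continuous_ln_re_zeval.
rewrite -[X in (_ * X)%E]fineK; last exact: integrable_fin_num.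
rewrite -EFinM lee_fin => mean.
have pi0 := pi_gt0 R.
rewrite -ler_pdivlMl ?mulr_gt0//; apply: mean => l l1 /=.
rewrite scalerA -{1}[z]scale1r -scalerDl scaler_eq0 negb_or z0 andbT.
(* A zero of 1 + l / 2 would give 1 = |l| / 2 <= 1/2. *)
apply/eqP => /eqP; rewrite addr_eq0 => /eqP/(congr1 Num.norm).
rewrite normr1 normrN normrM => e.
have : `|l| * `|(1 / 2)%:C%C| <= 1 * (1 / 2)%:C%C :> R[i].
  apply: ler_pM => //; rewrite ger0_norm// ler0c; lra.
by rewrite -e mul1r lecR; lra.
Qed.

Lemma psh_unit_circle_dir z : z != 0 ->
  exists s0 : R, forall t r s, 0 < t < 2 * pi -> 0 < r ->
    lam t = r%:C%C * expi s ->
    re_zeval P (expi s *: (expi s0 *: z)) = re_zeval P (expi s0 *: z).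
Proof.
move=> z0; have [s0 maxs0] := unit_circle_max z; exists s0.
set w := expi s0 *: z; have w0 : w != 0 by exact: expi_scale_neq0.
pose U t := ln (re_zeval P (lam t *: w)).
(* As [ln_circle (1 / 2) t] is 2 ln |lam t|, the radial part of [U] cancels: [h] is the deficit of u
   below its circle maximum in the direction of [lam t]. *)
pose h t := ln (re_zeval P w) + d%:R / 2 * ln_circle (1 / 2) t - U t.
have hE t r s : 0 < r -> lam t = r%:C%C * expi s ->
    h t = ln (re_zeval P w) - ln (re_zeval P (expi s *: w)).
  move=> r0 lamE; have r2 : 1 + 2 * (1 / 2) * cos t + (1 / 2) ^+ 2 = r ^+ 2.
    rewrite -lam_sqr_norm lamE /expi /=.
    by have := cos2Dsin2 s; nra.
  rewrite /h /U /ln_circle r2 lamE -scalerA re_zeval_real_scale//.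
  rewrite lnM ?posrE ?exprn_gt0//; last exact/P_pos/expi_scale_neq0.
  by rewrite !lnXn// -[_ *+ 2]mulr_natl -[_ *+ d]mulr_natl; field.
have h0 t : 0 <= h t.
  have [s _ [r [r0 _ lamE]]] := polar_decomposition (lam_neq0 t).
  rewrite (hE _ _ _ r0 lamE) subr_ge0 ler_ln ?posrE; last 2 first.
    exact/P_pos/expi_scale_neq0.
    exact: P_pos.
  by rewrite /w scalerA -expiD.
have cU : continuous U by exact: continuous_ln_re_zeval.
have cl : continuous (fun t => d%:R / 2 * ln_circle (1 / 2) t).
  move=> t; apply: cvgM; first exact: cvg_cst.
  by apply: continuous_ln_circle; exact: norm_half_le.
have cM : continuous (fun t : R => ln (re_zeval P w)).
  by move=> t; exact: cvg_cst.
have cMl : continuous (fun t => ln (re_zeval P w) + d%:R / 2 * ln_circle (1 / 2) t).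
  by move=> t; apply: cvgD; [exact: cM|exact: cl].
have ch : continuous h by move=> t; apply: cvgB; [exact: cMl|exact: cU].
(* The sub-mean inequality bounds the integral of [U] below by 2 pi ln rho(w), and the logarithmic
   term has nonpositive integral. *)
have inth : \int[mu]_(t in `[0, 2 * pi]) h t <= 0.
  rewrite RintegralB//; try exact: continuous_integrable_itv.
  rewrite RintegralD//; try exact: continuous_integrable_itv.
  rewrite RintegralZl//; last first.
    apply/continuous_integrable_itv/continuous_ln_circle; exact: norm_half_le.
  rewrite Rintegral_cst//= lebesgue_measure_itv /= lte_fin mulr_gt0 ?pi_gt0//=.
  have := psh_circle_mean w0; have := integral_ln_circle_le0 norm_half_le.
  rewrite subr0; set I := \int[mu]_(x in _) ln_circle _ _ => I0 mean.
  have : d%:R / 2 * I <= 0 by rewrite mulr_ge0_le0// divr_ge0.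
  by move: mean; rewrite /U; lra.
move=> t r s tI r0 lamE.
have := continuous_Rintegral_eq0 ch h0 inth tI; rewrite (hE _ _ _ r0 lamE).
move=> /eqP; rewrite subr_eq0 => /eqP e.
apply: ln_inj (esym e); rewrite posrE; last exact: P_pos.
exact/P_pos/expi_scale_neq0.
Qed.

(* The directions of [1 + e^(i t) / 2], for [t] in a sequence of pairwise
   distinct points of [(0, pi / 2)]. *)
Let dir k : R[i] :=
  let l := lam k.+1%:R^-1 in
  (Num.sqrt (complex.Re l ^+ 2 + complex.Im l ^+ 2))^-1%:C%C * l.

Lemma lam_sqrt_norm_gt0 t :
  0 < Num.sqrt (complex.Re (lam t) ^+ 2 + complex.Im (lam t) ^+ 2).
Proof. by rewrite sqrtr_gt0 lam_sqr_norm ln_circle_arg_gt0// norm_half_le. Qed.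

(** On (0, 1] sin increases and cos decreases, so the slope sin t / (2 + cos t) of [lam t] is
    strictly increasing. Slopes are compared by cross-multiplication. *)
Lemma dir_inj : injective dir.
Proof.
suff lt_dir a b : (a < b)%N -> dir a <> dir b.
  by move=> a b; case: (ltngtP a b) => [/lt_dir|/lt_dir /nesym|].
move=> ab; pose x : R := b.+1%:R^-1; pose y : R := a.+1%:R^-1.
have x0 : 0 < x by rewrite invr_gt0 ltr0n.
have xy : x < y by rewrite ltf_pV2 ?posrE ?ltr0n// ltr_nat.
have y1 : y <= 1 by rewrite invf_le1 ?ltr0n// ler1n.
have pi2 := pi_ge2 R.
have sin_xy : sin x < sin y by rewrite ltr_sin// in_itv/=; lra.
have cos_xy : cos y < cos x by rewrite ltr_cos// in_itv/=; lra.
have sx0 : 0 < sin x by rewrite sin_gt0_pi//; lra.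
have cy1 := cos_geN1 y.
rewrite /dir -/x -/y.
have := lam_sqrt_norm_gt0 x; rewrite -invr_gt0; set q := _^-1 => q0.
have := lam_sqrt_norm_gt0 y; rewrite -invr_gt0; set p := _^-1 => p0.
rewrite /lam /expi => -[]; rewrite !mul0r !subr0 !addr0 !add0r => re im.
have : (q * (1 / 2 * sin x)) * (p * (1 + 1 / 2 * cos y)) =
       (p * (1 / 2 * sin y)) * (q * (1 + 1 / 2 * cos x)) by rewrite im re.
have -> : q * (1 / 2 * sin x) * (p * (1 + 1 / 2 * cos y)) =
  (p * q) * ((1 / 2 * sin x) * (1 + 1 / 2 * cos y)) by ring.
have -> : p * (1 / 2 * sin y) * (q * (1 + 1 / 2 * cos x)) =
  (p * q) * ((1 / 2 * sin y) * (1 + 1 / 2 * cos x)) by ring.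
move=> /(mulfI (lt0r_neq0 (mulr_gt0 p0 q0))) /eqP; apply/negP.
by rewrite lt_eqF// ltr_pM//; lra.
Qed.

(** Scaling by 2 multiplies the monomial by 2 to its total degree, and powers of 2 determine their
    exponent. *)
Lemma msupp_degree m : m \in mpoly.msupp P ->
  (\sum_(j < n) m (lshift n j) + \sum_(j < n) m (rshift n j))%N = d.
Proof.
move=> mP.
have := zeval_scale_eq (fun z => zeval_real_scale 2 z P_homog) mP.
rewrite conjc_real -exprD; apply: ieexprIn; first by rewrite ltcR.
by rewrite eq_complex /= pnatr_eq1.
Qed.

(* On the unit circle [u^d = u^l u^m] and [u^* = u^-1], so that multiplying
   the Laurent polynomial [u |-> zeval P (u *: z)] by [u^d] turns the monomial
   [u^l (u^* )^m] into [u^(2 l)]. *)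
Lemma unit_circle_poly z : exists q : {poly R[i]},
  forall u, u * (u^*)%C = 1 ->
    q.[u] = u ^+ d * (zeval P (u *: z) - zeval P z).
Proof.
pose l (m : mpoly.multinom (n + n)) := (\sum_(j < n) m (lshift n j))%N.
pose M (m : mpoly.multinom (n + n)) :=
  \prod_i row_mx z (map_mx conjc z) ord0 i ^+ m i.
exists (\sum_(m <- mpoly.msupp P) (mpoly.mcoeff m P * M m) *: 'X^(2 * l m) -
  zeval P z *: 'X^d) => u uu1.
rewrite hornerD hornerN hornerZ hornerXn horner_sum mulrBr; congr (_ - _).
  rewrite zevalE_monomials mulr_sumr big_seq [RHS]big_seq.
  apply: eq_bigr => m mP; rewrite hornerZ hornerXn -/(l m) -/(M m).
  rewrite -(msupp_degree mP) -/(l m); set k := (\sum_(j < n) _)%N.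
  rewrite mul2n -addnn !exprD.
  transitivity (mpoly.mcoeff m P * M m * (u ^+ l m * u ^+ l m) *
    (u * (u^*)%C) ^+ k); first by rewrite uu1 expr1n mulr1.
  by rewrite exprMn; ring.
by rewrite mulrC.
Qed.

(** * Rotation invariance and the bidegree *)

Hypothesis P_real : real_valued P.

Lemma zeval_rotate t z : zeval P (expi t *: z) = zeval P z.
Proof.
have [->|z0] := eqVneq z 0; first by rewrite scaler0.
have [s0 dirE] := psh_unit_circle_dir z0.
set w := expi s0 *: z in dirE.
have [q qE] := unit_circle_poly w.
have q0 : q = 0.
  apply: (poly_injective_roots_eq0 dir_inj) => k; apply/rootP.
  have l0 := lam_neq0 k.+1%:R^-1.
  have [s _ [r [r0 r2 lamE]]] := polar_decomposition l0.
  have -> : dir k = expi s.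
    rewrite /dir -r2 sqrtr_sqr gtr0_norm// lamE mulrA -rmorphM /=.
    by rewrite mulVf ?gt_eqF// mul1r.
  rewrite qE ?expi_conjc_mul// !real_valued_zevalE// (dirE _ _ _ _ r0 lamE).
    by rewrite subrr mulr0.
  rewrite invr_gt0 ltr0n /=; apply: le_lt_trans (_ : 1 < _).
    by rewrite invf_le1 ?ltr0n// ler1n.
  by have := pi_ge2 R; lra.
have wE s : zeval P (expi s *: w) = zeval P w.
  have := qE (expi s) (expi_conjc_mul s); rewrite q0 horner0 => /esym/eqP.
  by rewrite mulf_eq0 expf_eq0 (negPf (expi_neq0 s)) andbF subr_eq0 => /eqP.
(* Invariance is known along the circle from the maximum point [w]; shifting the angle by [s0]
   transfers it to [z]. *)
have zE s : expi s *: z = expi (s - s0) *: w.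
  by rewrite /w scalerA -expiD subrK.
by rewrite -[in RHS](scale1r z) -expi0 !zE !wE.
Qed.

(** Rotation by pi is multiplication by -1; for odd [d] it would flip the sign of a positive
    value. *)
Lemma degree_even : (0 < n)%N -> ~~ odd d.
Proof.
move=> n0; pose z : 'rV[R[i]]_n := const_mx 1.
have z0 : z != 0.
  apply/eqP => /matrixP /(_ ord0 (Ordinal n0)); rewrite !mxE => /eqP.
  by rewrite oner_eq0.
have : re_zeval P ((- 1)%:C%C *: z) = re_zeval P z.
  have <- : expi pi = (- 1)%:C%C :> R[i] by rewrite /expi cospi sinpi.
  by rewrite /re_zeval zeval_rotate.
rewrite re_zeval_real_scale// -signr_odd; case: odd => //.
by rewrite expr1 mulN1r; have := P_pos z0; lra.
Qed.

(** Rotate by the angle 1 / (d + 1): both partial degrees are at most [d], so their difference times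
    this angle lies in (-1, 1), where sin vanishes only at 0. *)
Lemma msupp_bidegree m : m \in mpoly.msupp P ->
  (\sum_(j < n) m (lshift n j) = \sum_(j < n) m (rshift n j))%N.
Proof.
move=> mP; have := msupp_degree mP.
have rot z : zeval P (expi d.+1%:R^-1 *: z) = 1 * zeval P z.
  by rewrite zeval_rotate mul1r.
have := zeval_scale_eq rot mP; rewrite conjc_expi !expiX -expiD.
set k := (\sum_(j < n) _)%N; set l := (\sum_(j < n) _)%N => -[_ sin0] kl.
pose x : R := (k%:R - l%:R) / d.+1%:R.
have sinx0 : sin x = 0 by rewrite -sin0; congr sin; rewrite /x; ring.
have d0 : (0 : R) < d.+1%:R by rewrite ltr0n.
have [kd ld] : (k%:R : R) < d.+1%:R /\ (l%:R : R) < d.+1%:R.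
  by rewrite !ltr_nat -kl !ltnS leq_addr leq_addl.
have k0 : (0 : R) <= k%:R by [].
have l0 : (0 : R) <= l%:R by [].
have x1 : x < 1 by rewrite /x ltr_pdivrMr//; lra.
have xN1 : -1 < x by rewrite /x ltr_pdivlMr//; lra.
have pi2 := pi_ge2 R.
have [x0|x0|/eqP] := ltgtP x 0.
- have : 0 < sin (- x) by rewrite sin_gt0_pi//; lra.
  by rewrite sinN sinx0 oppr0 ltxx.
- have : 0 < sin x by rewrite sin_gt0_pi//; lra.
  by rewrite sinx0 ltxx.
by rewrite /x mulf_eq0 invr_eq0 (gt_eqF d0) orbF subr_eq0 eqr_nat => /eqP.
Qed.

End LineRestriction.

Theorem theorem4p1 (R : realType) (n : nat) (hn : (0 < n)%N)
    (rho : zpoly R n) (d : nat)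
    (rho_real : real_valued rho)
    (rho_homog : real_homogeneous d rho)
    (rho_pos : forall z : 'rV[R[i]]_n, z != 0 -> 0 < re_zeval rho z) :
  let u := fun z : 'rV[R[i]]_n => ln (re_zeval rho z) in
  plurisubharmonic [set z | z != 0] (fun z => (u z)%:E) ->
  (forall z : 'rV[R[i]]_n, z != 0 ->
     forall v : 'I_(n * 2) -> 'rV[R[i]]_n, wedge_pow (ddc u z) n v = 0) ->
  exists k : nat, d = (2 * k)%N /\ bihomogeneous k k rho.
Proof.
move=> u psh _.
have deven := degree_even rho_homog rho_pos psh rho_real hn.
exists d./2; split=> [|m mP]; first by rewrite mul2n even_halfK.
have lm := msupp_bidegree rho_homog rho_pos psh rho_real mP.
have := msupp_degree rho_homog mP; rewrite lm.
set s := (\sum_(j < n) _)%N => <-.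
by rewrite (addnn s) (doubleK s).
Qed.
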